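(* Let $T$ be a finite group, $m$ a positive integer, and let $G=D(T,m)$ be the diagonal group, acting on $\Omega=T^m$. (1) Every $G$-invariant partition of $\Omega$ is the right coset partition $\{Hx: x\in T^m\}$ of a subgroup $H$ of the group $T^m$ such that $H$ is mapped to itself by all the elements of types (c), (d) and (e). (2) If every subgroup $H$ of $T^m$ which is mapped to itself by all elements of types (c), (d) and (e) is normal in $T^m$, then $G$ is pre-primitive.
   Context: The diagonal group $D(T,m)$ is the group of permutations of $\Omega=T^m$ generated by the following elements: (a) elements of $T^m$, acting by right multiplication; (b) elements $t\in T$, acting simultaneously on all coordinates by left multiplication, $[x_1,\ldots,x_m]\mapsto[t^{-1}x_1,\ldots,t^{-1}x_m]$; (c) automorphisms of $T$, acting simultaneously on all coordinates; (d) elements of the symmetric group $S_m$, permuting the coordinates; (e) the map $[t_1,t_2,\ldots,t_m]\mapsto[t_1^{-1},t_1^{-1}t_2,\ldots,t_1^{-1}t_m]$. The point set $\Omega$ is identified with the group $T^m$, so that a subgroup $H$ of $T^m$ is also a subset of $\Omega$ on which the permutations of types (c), (d), (e) act. A partition of $\Omega$ is $G$-invariant if every $g\in G$ maps each part onto a part. The orbit partition of a subgroup is the partition of $\Omega$ into its orbits. A transitive permutation group $G$ on a finite set $\Omega$ is pre-primitive if every $G$-invariant partition of $\Omega$ is the orbit partition of some subgroup of $G$. *)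

(* Defs.v *)
From mathcomp Require Import all_boot all_fingroup.

Set Implicit Arguments.
Unset Strict Implicit.
Unset Printing Implicit Defensive.

Import GroupScope.

Section InvariantPartitions.

Variable rT : finType.
Implicit Types (G K : {group {perm rT}}) (P : {set {set rT}}).

Definition invariant_partition G P : bool :=
  partition P [set: rT] && [acts G, on P | 'P^*].

Definition orbit_partition K : {set {set rT}} :=
  [set orbit 'P K x | x in [set: rT]].

Definition preprimitive G : Prop :=
  [transitive G, on [set: rT] | 'P]
  /\ forall P, invariant_partition G P ->
       exists2 K : {group {perm rT}}, K \subset G & P = orbit_partition K.

End InvariantPartitions.

(* The dependent form {dffun forall _, _} is needed here: MathComp puts the
   direct product group structure on it, not on {ffun 'I_m -> T}. *)
Notation power_group T m := {dffun forall _ : 'I_m, T}.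

Section DiagonalGroup.

Variables (T : finGroupType) (m : nat).
Local Notation Tm := (power_group T m).
Implicit Types (x h : Tm) (t : T) (a : {perm T}) (s : 'S_m).

Definition diag_rmul h x : Tm := x * h.
Definition diag_lmul t x : Tm := [ffun i => t^-1 * x i].
Definition diag_aut a x : Tm := [ffun i => a (x i)].
Definition diag_coord s x : Tm := [ffun i => x (s i)].
Definition diag_twist (i0 : 'I_m) x : Tm :=
  [ffun i => if i == i0 then (x i0)^-1 else (x i0)^-1 * x i].

Lemma diag_rmul_inj h : injective (diag_rmul h).
Proof. exact: mulIg. Qed.

Lemma diag_lmul_inj t : injective (diag_lmul t).
Proof.
by move=> x y /ffunP exy; apply/ffunP=> i; have:= exy i; rewrite !ffunE => /mulgI.
Qed.

Lemma diag_aut_inj a : injective (diag_aut a).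
Proof.
by move=> x y /ffunP exy; apply/ffunP=> i; have:= exy i; rewrite !ffunE => /perm_inj.
Qed.

Lemma diag_coord_inj s : injective (diag_coord s).
Proof.
move=> x y /ffunP exy; apply/ffunP=> i.
by have:= exy (s^-1 i); rewrite !ffunE permKV.
Qed.

Lemma diag_twist_inj i0 : injective (diag_twist i0).
Proof.
move=> x y /ffunP exy.
have e0 : x i0 = y i0 by have:= exy i0; rewrite !ffunE eqxx => /invg_inj.
apply/ffunP=> i; have := exy i; rewrite !ffunE e0.
by case: eqP => [-> // | _ /mulgI].
Qed.

Definition diag_type_a : {set {perm Tm}} :=
  [set perm (@diag_rmul_inj h) | h in [set: Tm]].
Definition diag_type_b : {set {perm Tm}} :=
  [set perm (@diag_lmul_inj t) | t in [set: T]].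
Definition diag_type_c : {set {perm Tm}} :=
  [set perm (@diag_aut_inj a) | a in Aut [set: T]].
Definition diag_type_d : {set {perm Tm}} :=
  [set perm (@diag_coord_inj s) | s in [set: 'S_m]].
(* [i0] plays the role of the first coordinate. *)
Definition diag_type_e (i0 : 'I_m) : {set {perm Tm}} :=
  [set perm (@diag_twist_inj i0)].

Hypothesis m_gt0 : 0 < m.

Definition diag_type_cde : {set {perm Tm}} :=
  diag_type_c :|: diag_type_d :|: diag_type_e (Ordinal m_gt0).

Definition diagonal_group : {group {perm Tm}} :=
  <<diag_type_a :|: diag_type_b :|: diag_type_cde>>%G.

Definition cde_stable (H : {group Tm}) : Prop :=
  forall g, g \in diag_type_cde -> g @: H = H.

End DiagonalGroup.

(* Main.v *)
Require Import Defs.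
From mathcomp Require Import all_boot all_fingroup.

Import GroupScope.

(** The diagonal group contains all right translations of [T^m], and these
    alone force the shape of an invariant partition [P].  Let [H] be the part
    of [P] containing the identity.  Right translation by [h \in H] maps [H] to
    a part which contains [h = 1 * h], hence meets [H], hence equals [H]; so [H]
    is closed under products, and being finite it is a subgroup.  Right
    translation by [x] maps [H] to the part [H :* x] containing [x], so the
    parts are exactly the right cosets of [H] ([invariant_block_group]).
    The maps of types (c), (d) and (e) fix the identity, so they map [H] to a
    part meeting [H], which is [H] itself.

    If moreover [H] is normal, then [H :* x = x *: H], and [x *: H] is the orbit
    of [x] under right translations by elements of [H]; these form a subgroup of
    the diagonal group ([orbit_partition_rtrans]). *)

Section InvariantBlocks.

Variables (rT : finType) (G : {group {perm rT}}) (P : {set {set rT}}).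
Hypothesis invP : invariant_partition G P.

Lemma invariant_partition_im g B : g \in G -> B \in P -> g @: B \in P.
Proof.
case/andP: invP => _ actP Gg PB.
by move: (acts_act actP Gg B); rewrite PB.
Qed.

Lemma partition_part_eq A B x :
  A \in P -> B \in P -> x \in A -> x \in B -> A = B.
Proof.
case/andP: invP => /and3P[_ tiP _] _ PA PB Ax Bx.
by rewrite -(def_pblock tiP PA Ax) -(def_pblock tiP PB Bx).
Qed.

Lemma mem_invariant_pblock x : x \in pblock P x.
Proof. by case/andP: invP => /and3P[/eqP covP _ _] _; rewrite mem_pblock covP. Qed.

Lemma invariant_pblock_mem x : pblock P x \in P.
Proof. by case/andP: invP => /and3P[/eqP covP _ _] _; rewrite pblock_mem ?covP. Qed.

(** The image of the part of [x] is a part which still contains [x]. *)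
Lemma invariant_pblock_fix g x : g \in G -> g x = x -> g @: pblock P x = pblock P x.
Proof.
move=> Gg gx; apply: (@partition_part_eq _ _ x).
- exact/invariant_partition_im/invariant_pblock_mem.
- exact: invariant_pblock_mem.
- by rewrite -{1}gx imset_f ?mem_invariant_pblock.
- exact: mem_invariant_pblock.
Qed.

End InvariantBlocks.

Section RightTranslations.

Variables (gT : finGroupType) (G : {group {perm gT}}).
Hypothesis sRG : actperm 'R @* [set: gT] \subset G.

Lemma rtransE (h x : gT) : actperm 'R h x = x * h.
Proof. exact: actpermE. Qed.

Lemma mem_rtrans (h : gT) : actperm 'R h \in G.
Proof. by apply: (subsetP sRG); rewrite mem_morphim ?inE. Qed.

Lemma rtrans_im (h : gT) (A : {set gT}) : actperm 'R h @: A = A :* h.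
Proof. by rewrite -rcosetE; apply: eq_imset => x; rewrite rtransE. Qed.

Lemma rtrans_transitive : [transitive G, on [set: gT] | 'P].
Proof.
apply/imsetP; exists 1; rewrite ?inE //; apply/esym/eqP; rewrite -subTset.
apply/subsetP=> x _; apply/orbitP; exists (actperm 'R x); first exact: mem_rtrans.
by rewrite /= apermE rtransE mul1g.
Qed.

Section InvariantPartition.

Variable P : {set {set gT}}.
Hypothesis invP : invariant_partition G P.

Lemma invariant_rcoset B x : B \in P -> B :* x \in P.
Proof. by move=> PB; rewrite -rtrans_im (invariant_partition_im _ _ _ invP) ?mem_rtrans. Qed.

(** For [k] in the part [B] of [1], the part [B :* k] meets [B] in [k = 1 * k],
    so [B :* k = B]; finiteness makes closure under inverses automatic. *)
Lemma invariant_block_group_set : group_set (pblock P 1).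
Proof.
have P1 := invariant_pblock_mem _ _ _ invP 1.
have B1 := mem_invariant_pblock _ _ _ invP 1.
apply/group_setP; split=> // h k Bh Bk.
have <-: pblock P 1 :* k = pblock P 1.
  apply: (partition_part_eq _ _ _ invP _ _ k) => //; first exact: invariant_rcoset.
  by rewrite mem_rcoset mulgV.
by rewrite mem_rcoset mulgK.
Qed.

(** A part meeting [H :* x] in [x] coincides with it, and every part has
    such an [x]. *)
Lemma invariant_block_group :
  exists2 H : {group gT}, H = pblock P 1 :> {set gT} & P = rcosets H [set: gT].
Proof.
exists (group invariant_block_group_set) => //=.
have P1 := invariant_pblock_mem _ _ _ invP 1.
have B1 := mem_invariant_pblock _ _ _ invP 1.
apply/setP=> B; apply/idP/rcosetsP => [PB | [x _ ->]]; last exact: invariant_rcoset.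
have /set0Pn[x Bx]: B != set0.
  by case/andP: invP => /and3P[_ _ P0] _; apply: contraNneq P0 => <-.
exists x; rewrite ?inE //.
apply: (partition_part_eq _ _ _ invP _ _ x) => //; first exact: invariant_rcoset.
by rewrite mem_rcoset mulgV.
Qed.

End InvariantPartition.

(** The orbits of right translation by [H] are left cosets, which normality
    turns into right ones. *)
Lemma orbit_partition_rtrans (H : {group gT}) :
  H <| [set: gT] ->
  Defs.orbit_partition (actperm 'R @* H)%G = rcosets H [set: gT].
Proof.
case/andP=> _ nH; apply: eq_imset => x.
rewrite rcosetE norm_rlcoset ?(subsetP nH) ?inE //; apply/setP=> y.
apply/orbitP/lcosetP=> [[_ /morphimP[h _ Hh ->] <-] | [h Hh ->]].
  by exists h; rewrite //= apermE rtransE.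
exists (actperm 'R h); first by rewrite mem_morphim ?inE.
by rewrite /= apermE rtransE.
Qed.

End RightTranslations.

Section DiagonalGroup.

Variables (T : finGroupType) (m : nat) (m_gt0 : 0 < m).

Lemma diagonal_group_rtrans :
  actperm 'R @* [set: power_group T m] \subset diagonal_group T m_gt0.
Proof.
apply/subsetP=> _ /morphimP[h _ _ ->]; apply: mem_gen; rewrite !inE.
apply/orP; left; apply/orP; left; apply/imsetP; exists h; rewrite ?inE //.
by apply/permP=> x; rewrite rtransE permE.
Qed.

Lemma diag_type_cde_sub : diag_type_cde T m_gt0 \subset diagonal_group T m_gt0.
Proof. by apply: sub_gen; apply: subsetUr. Qed.

Lemma diag_type_cde1 g : g \in diag_type_cde T m_gt0 -> g 1 = 1.
Proof.
have one_ffunE (i : 'I_m) : (1 : power_group T m) i = 1 by rewrite ffunE.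
rewrite !inE -orbA => /or3P[/imsetP[a Aa ->] | /imsetP[s _ ->] | /eqP ->].
- apply/ffunP=> i; rewrite permE !ffunE.
  by rewrite -(autmE Aa) morph1.
- by apply/ffunP=> i; rewrite permE !ffunE.
- by apply/ffunP=> i; rewrite permE !ffunE invg1 mulg1 if_same.
Qed.

End DiagonalGroup.

Theorem proposition2p17 (T : finGroupType) (m : nat) (m_gt0 : 0 < m) :
  (forall P : {set {set power_group T m}},
     invariant_partition (diagonal_group T m_gt0) P ->
     exists2 H : {group power_group T m},
       cde_stable m_gt0 H & P = rcosets H [set: power_group T m])
  /\ ((forall H : {group power_group T m},
         cde_stable m_gt0 H -> H <| [set: power_group T m]) ->
      preprimitive (diagonal_group T m_gt0)).
Proof.
have sRG := diagonal_group_rtrans T m m_gt0.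
have part1 P : invariant_partition (diagonal_group T m_gt0) P ->
    exists2 H : {group power_group T m},
      cde_stable m_gt0 H & P = rcosets H [set: power_group T m].
  move=> invP; have [H defH defP] := invariant_block_group _ _ sRG _ invP.
  exists H => // g cde_g; rewrite defH.
  apply: (invariant_pblock_fix _ _ _ invP); last exact: diag_type_cde1 cde_g.
  exact: subsetP (diag_type_cde_sub T m m_gt0) g cde_g.
split=> // nrmH; split; first exact: rtrans_transitive sRG.
move=> P /part1[H /nrmH nH ->]; exists (actperm 'R @* H)%G.
  by apply: subset_trans sRG; apply: morphimS; apply: subsetT.
by rewrite orbit_partition_rtrans.
Qed.
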